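(* Let $X:g=0$ be a reduced affine hypersurface in $\mathbb{C}^n$ and let $\delta_i=\alpha_{i1}\partial_1+\cdots+\alpha_{in}\partial_n$, for $i=1,\ldots,n$, be $n$ derivations in $Der(X)$. Then $\delta_1,\ldots,\delta_n$ is a basis for the free $R$-module $Der(X)$ (that is, $Der(X)$ is free with basis $\delta_1,\ldots,\delta_n$) if and only if $$\det(\alpha_{ij})_{1\le i,j\le n}=c\cdot g$$ for some $c\in\mathbb{C}^*$.
   Context: $R=\mathbb{C}[x_1,\ldots,x_n]$, $\partial_j=\partial/\partial x_j$, and $g\in R$ is a nonconstant reduced (square-free) polynomial. $Der(R)=\{\alpha_1\partial_1+\cdots+\alpha_n\partial_n : \alpha_j\in R\}$ and $Der(X)=\{\partial\in Der(R):\partial g\in (g)\}$, an $R$-module. *)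

(* Defs.v *)
From HB Require Import structures.
From mathcomp Require Import all_boot all_order all_algebra.
From mathcomp Require Import complex mpoly.
From mathcomp Require Import boolp classical_sets functions reals.

Set Implicit Arguments.
Unset Strict Implicit.
Unset Printing Implicit Defensive.

Import GRing.Theory.
Local Open Scope ring_scope.

Section Module.
Variables (A : nzRingType) (M : lmodType A).

Definition lin_indep (k : nat) (v : 'I_k -> M) : Prop :=
  forall c : 'I_k -> A, \sum_i c i *: v i = 0 -> forall i, c i = 0.

(* The submodule N of M is free with basis v_0, ..., v_(k-1). *)
Definition is_basis_of (N : set M) (k : nat) (v : 'I_k -> M) : Prop :=
  [/\ forall i, N (v i),
      lin_indep v
    & forall x, N x -> exists c : 'I_k -> A, x = \sum_i c i *: v i].

End Module.

Section Ring.
Variable A : comUnitRingType.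

Definition principal_ideal (g : A) : set A := [set f | exists q, f = q * g].

Definition squarefree (g : A) : Prop :=
  forall p, principal_ideal (p ^+ 2) g -> p \is a GRing.unit.

End Ring.

Section Derivations.
Variables (n : nat) (K : idomainType).
Local Notation P := {mpoly K[n]}.

(* The operators P -> P, as a module over P (not only over K): this is why the
   codomain is written P^o, the regular P-module. *)
Definition operator : lmodType P := P -> P^o.

Definition nonconstant (g : P) : Prop := forall c : K, g <> c%:MP.

Definition vfield (a : 'I_n -> P) : operator :=
  \sum_j a j *: (@mderiv n K j : operator).

Definition Der : set operator := [set D | exists a, D = vfield a].

Definition DerX (g : P) : set operator :=
  [set D | Der D /\ principal_ideal g (D g)].

Lemma vfieldE a (f : P) : vfield a f = \sum_j a j * f^`M(j).
Proof. by rewrite /vfield fct_sumE. Qed.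

Lemma vfieldP (c : P) a b : c *: vfield a + vfield b = vfield (c \*o a \+ b).
Proof.
apply/funext => f.
have -> : (c *: vfield a + vfield b) f = c * (vfield a f : P) + vfield b f by [].
rewrite !vfieldE mulr_sumr -(big_split +%R).
by apply: eq_bigr => j _ /=; rewrite mulrDl mulrA.
Qed.

Lemma DerX_submod (g : P) : submod_closed (mem (DerX g)).
Proof.
split=> [|c D E]; rewrite !inE.
  split; last by exists 0; rewrite mul0r.
  by exists (fun=> 0); apply/funext => f; rewrite vfieldE big1 // => j; rewrite mul0r.
move=> [[a ->] [p Hp]] [[b ->] [q Hq]]; split; first by rewrite vfieldP; eexists.
exists (c * p + q); rewrite mulrDl -mulrA -Hp -Hq; reflexivity.
Qed.

End Derivations.

(* Main.v *)
Require Import Defs.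
From mathcomp Require Import all_boot all_order all_algebra.
From mathcomp Require Import complex mpoly.
From mathcomp Require Import boolp classical_sets functions reals.

(* Derivations in Der(X) kill the gradient of g modulo g, so by Cramer g divides
   det(alpha) d_j g for every j. As polynomial rings are factorial, and a prime
   factor of a reduced g cannot divide all the d_j g, g divides det(alpha); the
   same applies to alpha with one row replaced by a member of Der(X). If
   det(alpha) = c g, Cramer's rule then expands every member of Der(X) in the
   delta_i. Conversely, if the delta_i form a basis and det(alpha) = h g, the
   determinants of the families g d_1, ..., g d_n, and g d_j,
   (d_j g) d_k - (d_k g) d_j (k <> j), are multiples of h g; hence h divides
   powers of g and of every d_j g, so that h is a unit. *)

Set Implicit Arguments.
Unset Strict Implicit.
Unset Printing Implicit Defensive.

Import GRing.Theory.
Local Open Scope ring_scope.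

(* dvdr a b means that a divides b. *)
Local Notation dvdr := principal_ideal.

(** * Divisibility, prime elements and prime factorizations in a domain *)

Section Divisibility.
Variable A : idomainType.
Implicit Types a b c p q u : A.

Lemma dvdr_mulr a b c : dvdr a b -> dvdr a (b * c).
Proof. by move=> [q ->]; exists (q * c); rewrite mulrAC. Qed.

Lemma dvdr_mull a b c : dvdr a c -> dvdr a (b * c).
Proof. by move=> [q ->]; exists (b * q); rewrite mulrA. Qed.

Lemma dvdr_trans a b c : dvdr a b -> dvdr b c -> dvdr a c.
Proof. by move=> ab [q ->]; apply: dvdr_mull. Qed.

Lemma dvdr_add a b c : dvdr a b -> dvdr a c -> dvdr a (b + c).
Proof. by move=> [p ->] [q ->]; exists (p + q); rewrite mulrDl. Qed.

Lemma dvdr_opp a b : dvdr a b -> dvdr a (- b).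
Proof. by move=> [q ->]; exists (- q); rewrite mulNr. Qed.

Lemma dvdr_sum a (I : finType) (F : I -> A) :
  (forall i, dvdr a (F i)) -> dvdr a (\sum_i F i).
Proof.
move=> aF; elim/big_ind: _ => //; last exact: dvdr_add.
by exists 0; rewrite mul0r.
Qed.

Lemma dvdr_unit a u : u \is a GRing.unit -> dvdr a u -> a \is a GRing.unit.
Proof. by move=> Uu [q Eu]; move: Uu; rewrite Eu unitrM => /andP[]. Qed.

Definition prime_elt p : Prop :=
  [/\ p != 0, p \isn't a GRing.unit
    & forall a b, dvdr p (a * b) -> dvdr p a \/ dvdr p b].

Definition prime_factored a : Prop :=
  exists u (s : seq A), [/\ u \is a GRing.unit,
    forall p, p \in s -> prime_elt p & a = u * \prod_(p <- s) p].

Lemma prime_dvdr_exp p a k : prime_elt p -> dvdr p (a ^+ k) -> dvdr p a.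
Proof.
case=> _ Up pM; elim: k => [|k IHk].
  by move/(dvdr_unit (unitr1 _)); rewrite (negPf Up).
by rewrite exprS => /pM[].
Qed.

Lemma prime_dvdr_prod p u (s : seq A) : prime_elt p -> u \is a GRing.unit ->
  dvdr p (u * \prod_(q <- s) q) -> exists2 q, q \in s & dvdr p q.
Proof.
case=> _ Up pM Uu; elim: s => [|q s IHs].
  by rewrite big_nil mulr1 => /(dvdr_unit Uu); rewrite (negPf Up).
rewrite big_cons mulrCA => /pM[pq|/IHs[r rs pr]].
  by exists q; rewrite ?mem_head.
by exists r; rewrite ?inE ?rs ?orbT.
Qed.

(** In [q = w * p] the prime [q] divides [w] or [p]; if [w = v * q], cancelling [q] would make [p] a
    unit. *)
Lemma prime_dvdr_assoc p q : prime_elt p -> prime_elt q -> dvdr p q -> dvdr q p.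
Proof.
case=> _ Up _ [q0 _ qM] [w Eq].
have /qM[|] // : dvdr q (w * p) by exists 1; rewrite mul1r.
case=> v Ew; case/negP: Up; apply/unitrP; exists v.
suff: v * p = 1 by rewrite mulrC.
by apply: (mulfI q0); rewrite mulr1 [RHS]Eq Ew mulrA (mulrC q).
Qed.

Lemma unit_factored u : u \is a GRing.unit -> prime_factored u.
Proof. by move=> Uu; exists u, [::]; rewrite big_nil mulr1. Qed.

Lemma prime_factored1 p : prime_elt p -> prime_factored p.
Proof.
move=> pp; exists 1, [:: p]; rewrite unitr1 big_seq1 mul1r; split=> // q.
by rewrite inE => /eqP->.
Qed.

Lemma prime_factoredM a b :
  prime_factored a -> prime_factored b -> prime_factored (a * b).
Proof.
move=> [u [s [Uu ps ->]]] [v [t [Uv pt ->]]].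
exists (u * v), (s ++ t); split; first by rewrite unitrM Uu.
  by move=> p; rewrite mem_cat => /orP[/ps|/pt].
by rewrite big_cat /= mulrACA.
Qed.

Lemma prime_factored_nonunit a : prime_factored a -> a \isn't a GRing.unit ->
  exists2 p, prime_elt p & dvdr p a.
Proof.
move=> [u [[|p s] [Uu ps ->]]]; first by rewrite big_nil mulr1 Uu.
move=> _; exists p; first by apply: ps; rewrite mem_head.
by rewrite big_cons mulrCA mulrC; exists (u * \prod_(q <- s) q).
Qed.

End Divisibility.

(** Asking for factors that are prime, not just irreducible, makes uniqueness of the factorization
    automatic. *)
Definition factorial_domain (A : idomainType) : Prop :=
  forall a : A, a != 0 -> prime_factored a.

Lemma factorial_iso (A B : idomainType) (f : {rmorphism A -> B})
    (g : {rmorphism B -> A}) :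
  cancel f g -> cancel g f -> factorial_domain A -> factorial_domain B.
Proof.
move=> fK gK facA b b0.
have dvdf x y : dvdr (f x) y -> dvdr x (g y).
  by move=> [q ->]; exists (g q); rewrite rmorphM fK.
have dvdg x y : dvdr x (g y) -> dvdr (f x) y.
  by move=> [q E]; exists (f q); rewrite -rmorphM -E gK.
have [|u [s [Uu ps Eb]]] := facA (g b).
  by apply: contraNneq b0 => gb0; rewrite -(gK b) gb0 rmorph0.
exists (f u), [seq f p | p <- s]; split; first exact: rmorph_unit.
  move=> _ /mapP[p /ps[p0 Up pM] ->]; split.
  - by apply: contraNneq p0 => fp0; rewrite -(fK p) fp0 rmorph0.
  - by apply: contra Up => /(rmorph_unit g); rewrite fK.
  - by move=> x y /dvdf; rewrite rmorphM => /pM[] /dvdg; [left|right].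
by rewrite big_map -rmorph_prod -rmorphM -Eb gK.
Qed.

(** * Gauss's lemma and factoriality of univariate polynomial rings *)

Section GaussLemma.
Variable A : idomainType.
Implicit Types (p c : A) (f g h : {poly A}).

Lemma prime_polyC p : prime_elt p -> prime_elt p%:P.
Proof.
move=> [p0 Up pM]; split; first by rewrite polyC_eq0.
  by rewrite poly_unitE coefC eqxx (negPf Up) andbF.
have dvd_lead f : dvdr p%:P f -> dvdr p (lead_coef f).
  by move=> [q ->]; exists (lead_coef q); rewrite lead_coefM lead_coefC.
have dvd_mon c k : dvdr p c -> dvdr p%:P (c *: 'X^k).
  by move=> [q ->]; exists (q *: 'X^k); rewrite -!mul_polyC polyCM mulrAC.
pose tl f := f - lead_coef f *: 'X^((size f).-1).
have size_tl f : f != 0 -> (size (tl f) < size f)%N.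
  move=> f0; rewrite -[X in (_ < X)%N]prednK ?size_poly_gt0 // ltnS.
  apply/leq_sizeP => j; rewrite leq_eqVlt /tl coefB coefZ coefXn.
  move=> /orP[/eqP<-|jl].
    by rewrite eqxx mulr1 subrr.
  by rewrite gtn_eqF // mulr0 subr0 nth_default //
    -(prednK (n := size f)) ?size_poly_gt0.
have tlE f : f = tl f + lead_coef f *: 'X^((size f).-1) by rewrite /tl subrK.
have dvd0 : dvdr p%:P 0 by exists 0; rewrite mul0r.
move=> f g; have [m] := ubnP (size f + size g)%N.
elim: m f g => // m IHm f g; rewrite ltnS => lm fg.
have [->|f0] := eqVneq f 0; first by left.
have [->|g0] := eqVneq g 0; first by right.
have /pM[pf|pg] : dvdr p (lead_coef f * lead_coef g).
  by rewrite -lead_coefM; apply: dvd_lead.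
- have [||dtf|] := IHm (tl f) g; last by right.
  + by apply: leq_trans lm; rewrite ltn_add2r size_tl.
  + rewrite /tl mulrBl; apply: dvdr_add => //; apply/dvdr_opp/dvdr_mulr.
    exact: dvd_mon.
  + by left; rewrite (tlE f); apply: dvdr_add => //; apply: dvd_mon.
- have [|||dtg] := IHm f (tl g); last 2 first.
  + by left.
  + by right; rewrite (tlE g); apply: dvdr_add => //; apply: dvd_mon.
  + by apply: leq_trans lm; rewrite ltn_add2l size_tl.
  + rewrite /tl mulrBr; apply: dvdr_add => //; apply/dvdr_opp/dvdr_mull.
    exact: dvd_mon.
Qed.

Hypothesis facA : factorial_domain A.

(** Trivial content, expressed without a gcd of the coefficients. *)
Definition primitive f : Prop := forall p, prime_elt p -> ~ dvdr p%:P f.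

Lemma factored_polyC c : c != 0 -> prime_factored c%:P.
Proof.
move=> /facA[u [s [Uu ps ->]]]; exists u%:P, [seq p%:P | p <- s]; split.
- exact: rmorph_unit.
- by move=> _ /mapP[p /ps pp ->]; apply: prime_polyC.
- by rewrite big_map -rmorph_prod -polyCM.
Qed.

(** The primes of [c] stay prime as constant polynomials, so each can be cancelled from [g] or from
    [h]. This clears denominators without passing to the fraction field. *)
Lemma scale_split c f g h : c != 0 -> c *: f = g * h ->
  exists a b g' h', [/\ a != 0, b != 0, g = a *: g', h = b *: h' & f = g' * h'].
Proof.
move=> /facA[u [s [Uu ps ->]]] {c}.
elim: s g h ps => [|p s IHs] g h ps.
  rewrite big_nil mulr1 => E; exists u, 1, (u^-1 *: g), h.
  have u0 : u != 0 by apply: contraTneq Uu => ->; rewrite unitr0.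
  rewrite oner_neq0 scale1r scalerA divrr // scale1r; split=> //.
  by rewrite -scalerAl -E scalerA mulVr // scale1r.
have pp : prime_elt p by apply: ps; rewrite mem_head.
have {}ps q : q \in s -> prime_elt q by move=> sq; apply: ps; rewrite inE sq orbT.
have [p0 _ _] := pp; have [pP0 _ pPM] := prime_polyC pp.
rewrite big_cons mulrCA -scalerA -mul_polyC => E.
have /pPM[[q Eq]|[q Eq]] : dvdr p%:P (g * h) by rewrite -E mulrC; eexists.
- have [|a [b [g' [h' [a0 b0 Eg Eh Ef]]]]] := IHs q h ps.
    by apply: (mulfI pP0); rewrite E Eq mulrA (mulrC q).
  exists (p * a), b, g', h'; split; rewrite ?mulf_neq0 //.
  by rewrite Eq Eg mulrC mul_polyC scalerA.
- have [|a [b [g' [h' [a0 b0 Eg Eh Ef]]]]] := IHs g q ps.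
    by apply: (mulfI pP0); rewrite E Eq mulrA mulrC.
  exists a, (p * b), g', h'; split; rewrite ?mulf_neq0 //.
  by rewrite Eq Eh mulrC mul_polyC scalerA.
Qed.

(** After [scale_split], [f = b *: f'] with [f'] dividing [g]; a prime factor of [b] would divide
    the primitive [f], so [b] is a unit. *)
Lemma primitive_dvdr c f g q : primitive f -> c != 0 -> c *: g = q * f ->
  dvdr f g.
Proof.
move=> primf c0 /(scale_split c0)[a [b [q' [f' [a0 b0 _ Ef ->]]]]].
have [Ub|Ub] := boolP (b \is a GRing.unit).
  exists (b^-1 *: q'); rewrite Ef -scalerAr -scalerAl scalerA mulrV //.
  by rewrite scale1r.
have [p pp [v Eb]] := prime_factored_nonunit (facA b0) Ub.
case: (primf p pp); exists (v *: f').
by rewrite Ef Eb [RHS]mulrC mul_polyC scalerA (mulrC p).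
Qed.

(** A constant prime dividing [f] divides its leading coefficient, so only the finitely many primes
    in a factorization of that coefficient have to be stripped off. *)
Lemma content_split f : f != 0 ->
  exists c g, [/\ c != 0, f = c *: g & primitive g].
Proof.
move=> f0; have [|u [s [Uu ps Ef]]] := facA (a := lead_coef f).
  by rewrite lead_coef_eq0.
suff [c [g [t [c0 Efg pt Eg ng]]]] : exists c g t, [/\ c != 0, f = c *: g,
    forall p, p \in t -> prime_elt p, lead_coef g = u * \prod_(p <- t) p
    & forall p, p \in t -> ~ dvdr p%:P g].
  exists c, g; split=> // p pp pg.
  have [q qt pq] : exists2 q, q \in t & dvdr p q.
    apply: prime_dvdr_prod pp Uu _; rewrite -Eg.
    by case: pg => w ->; exists (lead_coef w); rewrite lead_coefM lead_coefC.
  apply: (ng q qt); apply: dvdr_trans pg.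
  have [w ->] := prime_dvdr_assoc pp (pt q qt) pq.
  by exists w%:P; rewrite polyCM.
(* t collects the primes of lead_coef f already found not to divide f. *)
have {Ef}: lead_coef f = u * \prod_(p <- s) p * \prod_(p <- [::]) p.
  by rewrite big_nil mulr1.
have: forall p, p \in [::] -> prime_elt p /\ ~ dvdr p%:P f by [].
move: [::] => t; elim: s f f0 t ps => [|p s IHs] f f0 t ps pt.
  rewrite big_nil mulr1 => Ef; exists 1, f, t; rewrite oner_neq0 scale1r.
  by split=> // q /pt[].
have pp : prime_elt p by apply: ps; rewrite mem_head.
have {}ps q : q \in s -> prime_elt q by move=> sq; apply: ps; rewrite inE sq orbT.
have [p0 _ _] := pp.
rewrite big_cons => Ef; have [[g Eg]|npf] := pselect (dvdr p%:P f).
  have g0 : g != 0 by apply: contraNneq f0 => g0; rewrite Eg g0 mul0r.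
  have [q qt||c [h [r [c0 Egh pr Eh nh]]]] := IHs g g0 t ps.
  - have [pq nqf] := pt q qt; split=> // qg; apply: nqf.
    by rewrite Eg; apply: dvdr_mulr.
  - apply: (mulfI p0); rewrite -[p in LHS]lead_coefC mulrC -lead_coefM -Eg Ef.
    by rewrite -!mulrA (mulrCA u).
  - exists (p * c), h, r; split; rewrite ?mulf_neq0 //.
    by rewrite Eg Egh mulrC mul_polyC scalerA.
apply: (IHs f f0 (p :: t) ps) => [q|].
  by rewrite inE => /orP[/eqP->|/pt].
by rewrite big_cons Ef -!mulrA; congr (_ * _); rewrite mulrCA.
Qed.

(* The pseudo-gcd of f and g divides f only up to scalars; scale_split turns it
   into a true divisor of f of the same degree. *)
Lemma primitive_prime f : (1 < size f)%N -> primitive f ->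
  (forall g h, f = g * h -> (size f <= size g)%N \/ (size f <= size h)%N) ->
  prime_elt f.
Proof.
move=> sf primf irrf; have f0 : f != 0 by rewrite -size_poly_gt0 ltnW.
split=> // [|g h [q E]].
  by rewrite poly_unitE gtn_eqF.
have [c c0 Ed] : exists2 cq : A * {poly A},
    cq.1 != 0 & cq.1 *: f = cq.2 * gcdp f g.
  exact/Pdiv.Idomain.dvdpP/dvdp_gcdl.
have [a [b [e [d [a0 b0 _ Eb Ef]]]]] := scale_split c0 Ed.
have sd : size d = size (gcdp f g) by rewrite Eb size_scale.
have /norP[e0 d0] : ~~ ((e == 0) || (d == 0)) by rewrite -mulf_eq0 -Ef.
(* Over a domain [%|] is divisibility up to a nonzero scalar, which primitivity of [f] removes. *)
have fdvdP (k : {poly A}) : (f %| k)%R -> dvdr f k.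
  by case/Pdiv.Idomain.dvdpP => -[c' q'] /=; apply: primitive_dvdr.
(* Either the gcd is constant, so [f] and [g] are coprime and [f] divides [h], or it has the size of
   [f] and [f] divides [g]. *)
have [se|] := irrf e d Ef.
  right; apply: fdvdP; rewrite -(@Gauss_dvdpr _ _ g).
    by rewrite E dvdp_mull.
  rewrite coprimep_def -sd eqn_leq size_poly_gt0 d0 andbT.
  move: se; have := size_mul e0 d0; rewrite -Ef => ->; rewrite -subn1 leq_subLR.
  by rewrite addnC leq_add2r.
rewrite sd => fd; left; apply: fdvdP.
have /dvdp_size_eqp : (gcdp f g %| f)%R by apply: dvdp_gcdl.
rewrite eqn_leq fd dvdp_leq ?dvdp_gcdl // => /esym/eqp_dvdl <-.
exact: dvdp_gcdr.
Qed.

(** Induction on the size: once the content is split off, the primitive part either is a product of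
    two polynomials of smaller size or is prime. *)
Theorem factorial_poly : factorial_domain {poly A}.
Proof.
move=> f; have [m] := ubnP (size f); elim: m f => // m IHm f.
rewrite ltnS => sf f0.
have [/size1_polyC Ef|sf1] := leqP (size f) 1.
  by rewrite Ef; apply: factored_polyC; rewrite -polyC_eq0 -Ef.
have [c [h [c0 Ef primh]]] := content_split f0.
have sh : size h = size f by rewrite Ef size_scale.
rewrite Ef -mul_polyC; apply: prime_factoredM; first exact: factored_polyC.
have h0 : h != 0 by rewrite -size_poly_gt0 sh ltnW.
have [[a [b [Eh [sa sb]]]]|irrh] := pselect (exists a b : {poly A},
    h = a * b /\ (size a < size f)%N /\ (size b < size f)%N).
  have /norP[a0 b0] : ~~ ((a == 0) || (b == 0)) by rewrite -mulf_eq0 -Eh.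
  by rewrite Eh; apply: prime_factoredM; apply: IHm => //; apply: leq_trans sf.
apply/prime_factored1/primitive_prime; rewrite ?sh // => a b Eh.
have [sa|] := leqP (size f) (size a); first by left.
have [sb|] := leqP (size f) (size b); first by right.
by move=> sb sa; case: irrh; exists a, b.
Qed.

End GaussLemma.

(** * Factoriality of multivariate polynomial rings over a field *)

Section MpolyFactorial.
Variable K : fieldType.

Lemma muniX n (m : 'X_{1..n.+1}) : muni ('X_[m] : {mpoly K[n.+1]}) =
  'X_[[multinom m (widen_ord (leqnSn n) i) | i < n]] *: 'X^(m ord_max).
Proof. by rewrite muniE msuppX big_seq1 mcoeffX eqxx scale1r. Qed.

Lemma muni_mwiden n (p : {mpoly K[n]}) : muni (mwiden p) = p%:P.
Proof.
rewrite {1 2}(mpolyE p) (raddf_sum (@mwiden n K)) !rmorph_sum.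
apply: eq_bigr => m _ /=.
rewrite mwidenZ mwidenX muniZ muniX mnmwiden_ordmax expr0 -!mul_polyC mulr1.
rewrite -mul_mpolyC rmorphM /=; congr (_ * 'X_[_]%:P).
by apply/mnmP => i; rewrite mnmE mnmwiden_widen.
Qed.

Lemma muni_ord_max n : muni ('X_ord_max : {mpoly K[n.+1]}) = 'X.
Proof.
rewrite muniX mnm1E eqxx expr1 (_ : [multinom _ | i < n] = 0%MM).
  by rewrite mpolyX0 scale1r.
apply/mnmP => i; rewrite mnmE mnm1E mnm0E -val_eqE /=.
by rewrite gtn_eqF.
Qed.

(** Induction on [n]: [muni] reads a polynomial as univariate in its last variable, and its inverse
    evaluates at ['X_ord_max]. *)
Theorem factorial_mpoly n : factorial_domain {mpoly K[n]}.
Proof.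
elim: n => [|n IHn].
  move=> p p0; apply: unit_factored; rewrite (nvar0_mpolyC p).
  apply: rmorph_unit; rewrite unitfE; apply: contraNneq p0 => p00.
  by rewrite (nvar0_mpolyC p) p00 mpolyC0.
have cX : commr_rmorph (@mwiden n K) 'X_ord_max by move=> p; apply: mulrC.
apply: (factorial_iso (f := horner_morph cX) (g := @muni n K)) => [q|p|].
- rewrite -[q in LHS]coefK poly_def !rmorph_sum /= -[RHS]coefK poly_def.
  apply: eq_bigr => i _; rewrite -mul_polyC !rmorphM /= horner_morphC muni_mwiden.
  by rewrite !rmorphXn /= horner_morphX muni_ord_max.
- rewrite /= muniE rmorph_sum [RHS]mpolyE; apply: eq_bigr => m _ /=.
  rewrite -mul_polyC rmorphM /= horner_morphC rmorphXn /= horner_morphX.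
  rewrite mwidenZ mwidenX -scalerAl mpolyXn -mpolyXD; congr (_ *: 'X_[_]).
  apply/mnmP => i; rewrite mnmDE mulmnE mnm1E.
  case: (unliftP ord_max i) => [j ->|->].
    rewrite (_ : lift _ _ = widen_ord (leqnSn n) j); last first.
      by apply/val_inj; rewrite /= /bump leqNgt ltn_ord.
    by rewrite mnmwiden_widen mnmE -val_eqE /= gtn_eqF // addn0.
  by rewrite mnmwiden_ordmax eqxx mul1n.
- exact: factorial_poly.
Qed.

End MpolyFactorial.

(** * Prime factors and partial derivatives in characteristic zero *)

Section Calculus.
Variables (K : fieldType) (n : nat).
Hypothesis charK : [pchar K] =i pred0.
Local Notation P := {mpoly K[n]}.
Implicit Types (p g h D : P).

(** If [m j] is nonzero, the [j]-th derivative has at [m - U_(j)] the coefficient [m j] times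
    [p@_m], and characteristic zero allows [m j] to be cancelled. *)
Lemma mderiv_eq0_const p : (forall j, p^`M(j) = 0) -> p = (p@_0)%:MP.
Proof.
move=> dp0; apply/mpolyP => m; rewrite mcoeffC.
have [->|m0] := eqVneq m 0%MM; first by rewrite mulr1.
rewrite mulr0.
have [j mj] : exists j, m j != 0%N.
  apply/existsP; apply: contraNT m0 => /existsPn m0.
  by apply/eqP/mnmP => j; rewrite mnm0E; apply/eqP; rewrite -[_ == _]negbK m0.
have Em : (m - U_(j) + U_(j))%MM = m.
  by apply: submK; rewrite lep1mP.
have /eqP := congr1 (fun q : P => q@_(m - U_(j))) (dp0 j).
rewrite mcoeff_mderiv Em mcoeff0 -mulr_natr mulf_eq0 => /orP[/eqP //|].
by rewrite ((pcharf0P K).1 charK).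
Qed.

Lemma msize_mderiv_lt p j : p != 0 -> (msize p^`M(j) < msize p)%N.
Proof.
move=> p0; rewrite [X in (_ < X)%N]mpolySpred // ltnS msizeE.
apply/bigmax_leqP_seq => m mdp _.
suff: (m + U_(j))%MM \in msupp p.
  by move/msize_mdeg_lt; rewrite mdegD mdeg1 addn1 mpolySpred.
move: mdp; rewrite !mcoeff_msupp mcoeff_mderiv; apply: contraNneq => ->.
by rewrite mul0rn.
Qed.

Lemma dvdr_msize p q : q != 0 -> dvdr p q -> (msize p <= msize q)%N.
Proof.
move=> q0 [r Eq]; move: q0; rewrite Eq mulf_eq0 => /norP[r0 p0].
by rewrite msizeM // (mpolySpred _ r0) addSn leq_addl.
Qed.

(** Derivatives have smaller degree, so if [p] divided them all they would vanish and [p] would be a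
    nonzero constant, hence a unit. *)
Lemma prime_ndvdr_mderiv p : prime_elt p -> exists j, ~ dvdr p p^`M(j).
Proof.
move=> [p0 Up _]; apply/existsNP => pdp; case/negP: Up.
have Ep : p = (p@_0)%:MP.
  apply: mderiv_eq0_const => j; apply/eqP/negPn/negP => dp0.
  by have := dvdr_msize dp0 (pdp j); rewrite leqNgt msize_mderiv_lt.
rewrite Ep; apply: rmorph_unit; rewrite unitfE.
by apply: contraNneq p0 => pc0; rewrite Ep pc0 mpolyC0.
Qed.

(** With [g = u * p], the product rule shows that otherwise [p] divides [u], and then [p ^+ 2]
    divides [g]. *)
Lemma prime_ndvdr_mderiv_squarefree p g : squarefree g -> prime_elt p ->
  dvdr p g -> exists j, ~ dvdr p g^`M(j).
Proof.
move=> sqf pp [u Eg]; have [j npdp] := prime_ndvdr_mderiv pp.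
exists j; rewrite Eg mderivM => pdg; have [_ Up pM] := pp.
have /pM[[v Eu]|//] : dvdr p (u * p^`M(j)).
  rewrite -[u * _](addKr (u^`M(j) * p)).
  by apply: dvdr_add => //; apply: dvdr_opp; eexists.
by case/negP: Up; apply: sqf; exists v; rewrite Eg Eu -mulrA expr2.
Qed.

(** The primes of [g] are collected in [D] one at a time: after the earlier ones are cancelled, the
    next prime [p] divides the cofactor [d] times every derivative of [g], and some derivative is
    prime to [p]. *)
Lemma squarefree_dvdr_grad g D : g != 0 -> squarefree g ->
  (forall j, dvdr g (D * g^`M(j))) -> dvdr g D.
Proof.
move=> g0 sqf gD; have [u [s [Uu ps Eg]]] := factorial_mpoly g0.
suff [d ->] : dvdr (\prod_(p <- s) p) D.
  by exists (d * u^-1); rewrite Eg mulrA divrK.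
have: dvdr (\prod_(p <- s) p) g by exists u.
elim: s ps {Eg} => [|p s IHs] ps; first by exists D; rewrite big_nil mulr1.
rewrite big_cons => -[w Eg]; have [||d Ed] := IHs.
- by move=> q sq; apply: ps; rewrite inE sq orbT.
- by exists (w * p); rewrite -mulrA.
have pp : prime_elt p by apply: ps; rewrite mem_head.
have [_ _ pM] := pp.
have [|j npj] := prime_ndvdr_mderiv_squarefree sqf pp (g := g).
  by exists (w * \prod_(q <- s) q); rewrite Eg mulrA mulrAC.
have /pM[[v Ev]|//] : dvdr p (d * g^`M(j)).
  have [q Eq] := gD j; exists (q * w).
  have s0 : \prod_(q <- s) q != 0.
    by apply: contraNneq g0 => s0; rewrite Eg s0 !mulr0.
  by apply: (mulIf s0); rewrite mulrAC -Ed Eq Eg !mulrA.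
by exists v; rewrite Ed Ev -mulrA.
Qed.

Lemma dvdr_exp_grad_unit g h k : g != 0 -> squarefree g -> dvdr h (g ^+ k) ->
  (forall j, dvdr h (g^`M(j) ^+ k)) -> h \is a GRing.unit.
Proof.
move=> g0 sqf hg hdg; have h0 : h != 0.
  by case: hg => q; apply: contra_eq_neq => ->; rewrite mulr0 expf_neq0.
apply/negPn/negP => Uh.
have [p pp ph] := prime_factored_nonunit (factorial_mpoly h0) Uh.
have pg : dvdr p g by apply: (prime_dvdr_exp pp); apply: dvdr_trans hg.
have [j []] := prime_ndvdr_mderiv_squarefree sqf pp pg.
by apply: (prime_dvdr_exp pp); apply: dvdr_trans (hdg j).
Qed.

End Calculus.

(** * Determinants of families in Der(X) and the basis criterion *)

Section Saito.
Variables (K : fieldType) (n : nat).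
Hypothesis charK : [pchar K] =i pred0.
Local Notation P := {mpoly K[n]}.
Variable g : P.
Hypotheses (g0 : g != 0) (g_squarefree : squarefree g).
Implicit Types (A B : 'M[P]_n).

(** Applying the field to the coordinate ['X_j] recovers its [j]-th coefficient. *)
Lemma vfield_inj (a b : 'I_n -> P) : vfield a = vfield b -> a =1 b.
Proof.
move=> Eab j; have := congr1 (fun D : operator n K => D 'X_j) Eab.
have vX (c : 'I_n -> P) : vfield c 'X_j = c j.
  rewrite vfieldE (bigD1 j) //= mderivX mnm1E eqxx big1 => [|i ij].
    rewrite scale1r addr0 (_ : (U_(j) - U_(j))%MM = 0%MM) ?mpolyX0 ?mulr1 //.
    by apply/mnmP => i; rewrite mnmBE subnn mnm0E.
  by rewrite mderivX mnm1E eq_sym (negPf ij) scale0r mulr0.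
by rewrite !vX.
Qed.

Lemma sum_vfield (c : 'I_n -> P) A :
  \sum_i c i *: vfield (A i) = vfield (fun j => \sum_i c i * A i j).
Proof.
apply/funext => f; rewrite fct_sumE vfieldE.
under [RHS]eq_bigr do rewrite mulr_suml.
rewrite exchange_big; apply: eq_bigr => i _.
rewrite -[LHS]/(c i * (vfield (A i) f : P)) vfieldE mulr_sumr.
by apply: eq_bigr => j _; rewrite mulrA.
Qed.

Lemma DerXP (a : 'I_n -> P) :
  DerX g (vfield a) <-> dvdr g (\sum_j a j * g^`M(j)).
Proof.
rewrite /DerX /= vfieldE; split=> [[]//|ga]; split=> //; by exists a.
Qed.

(* Cramer's rule: A kills the gradient of g modulo g, hence so does \det A. *)
Lemma DerX_dvdr_det A : (forall i, DerX g (vfield (A i))) -> dvdr g (\det A).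
Proof.
move=> gA; apply: (squarefree_dvdr_grad charK g0 g_squarefree) => j.
pose grad : 'cV[P]_n := \col_k g^`M(k).
have -> : \det A * g^`M(j) = (\adj A *m (A *m grad)) j 0.
  by rewrite mulmxA mul_adj_mx mul_scalar_mx !mxE.
rewrite mxE; apply: dvdr_sum => k; apply: dvdr_mull; rewrite mxE.
by under eq_bigr do rewrite mxE; apply/DerXP.
Qed.

Definition row_subst A i (b : 'I_n -> P) : 'M[P]_n :=
  \matrix_(k, j) (if k == i then b j else A k j).

(** Expansion along row [i], whose cofactors do not see the substitution. The sum is entry [i] of
    [b] times the adjugate, the numerator in Cramer's rule. *)
Lemma det_row_subst A i (b : 'I_n -> P) :
  \det (row_subst A i b) = \sum_j b j * \adj A j i.
Proof.
rewrite (expand_det_row _ i); apply: eq_bigr => j _.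
rewrite !mxE eqxx; congr (_ * (_ * \det _)).
by apply/matrixP => k l; rewrite !mxE eq_sym (negPf (neq_lift _ _)).
Qed.

Definition DerX_basis A : Prop :=
  is_basis_of (DerX g) (fun i : 'I_n => vfield (A i)).

Lemma DerX_basis_det A :
  (forall i, DerX g (vfield (A i))) -> DerX_basis A ->
  exists c : K, c != 0 /\ \det A = c *: g.
Proof.
move=> gA [_ _ spanA]; have [h Eh] := DerX_dvdr_det gA.
(* Expanding the rows of [B] in the basis writes [B] as a matrix times [A]. *)
have dvd_det B : (forall i, DerX g (vfield (B i))) -> dvdr (\det A) (\det B).
  move=> gB; have [C EC] := choice (fun i => spanA _ (gB i)).
  exists (\det (\matrix_i (\row_k C i k))); rewrite -det_mulmx; congr (\det _).
  apply/matrixP => i j; rewrite mxE.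
  have /vfield_inj -> := etrans (EC i) (sum_vfield _ _).
  by apply: eq_bigr => k _; rewrite !mxE.
have hU : h \is a GRing.unit.
  apply: (dvdr_exp_grad_unit charK (k := n) g0 g_squarefree) => [|j].
    apply: (@dvdr_trans _ _ (\det A)); first by exists g; rewrite Eh mulrC.
    rewrite -det_scalar; apply: dvd_det => i; apply/DerXP.
    rewrite (bigD1 i) //= mxE eqxx big1 => [|k ik].
      by rewrite addr0; exists g^`M(i); rewrite mulrC.
    by rewrite mxE eq_sym (negPf ik) mul0r.
  (* The rows are g d_j and the Hamiltonian fields (d_j g) d_k - (d_k g) d_j,
     which annihilate g. *)
  pose B : 'M[P]_n := \matrix_(k, l) (if k == j then g *+ (l == j)
    else g^`M(j) *+ (l == k) - g^`M(k) *+ (l == j)).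
  (* Row [j] has the single nonzero entry [g], on the diagonal; deleting row and column [j] leaves a
     scalar matrix of size [n.-1]. *)
  have detB : \det B = g * g^`M(j) ^+ n.-1.
    rewrite (expand_det_row _ j) (bigD1 j) //= mxE !eqxx mulr1n big1 ?addr0.
      rewrite /cofactor -signr_odd addnn odd_double expr0 mul1r; congr (_ * _).
      rewrite -det_scalar; congr (\det _); apply/matrixP => k l.
      have jl m : (lift j m == j) = false
        by rewrite eq_sym (negPf (neq_lift _ _)).
      by rewrite !mxE !jl subr0 (inj_eq lift_inj) eq_sym.
    by move=> l lj; rewrite mxE eqxx (negPf lj) mul0r.
  have [q] : dvdr (\det A) (\det B).
    apply: dvd_det => k; apply/DerXP; have [Ek|kj] := eqVneq k j.
      rewrite (eq_bigr (fun l => g * (g^`M(l) *+ (l == j)))) => [|l _].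
        by rewrite -mulr_sumr; eexists; rewrite mulrC.
      by rewrite mxE Ek eqxx mulrnAl mulrnAr.
    exists 0; rewrite mul0r.
    under eq_bigr do rewrite mxE (negPf kj) mulrBl !mulrnAl !mulrb.
    by rewrite sumrB -!big_mkcond !big_pred1_eq mulrC subrr.
  have n_gt0 : (0 < n)%N by apply: leq_ltn_trans (ltn_ord j).
  (* Cancelling [g] yields exponent [n.-1]; one more derivative factor raises it to [n], the
     exponent shared with the power of [g]. *)
  rewrite detB Eh => E; exists (q * g^`M(j)); apply: (mulfI g0).
  rewrite -[X in _ ^+ X](prednK n_gt0) exprSr mulrA E.
  by rewrite (mulrC h) (mulrCA q) (mulrAC q _ h) -[LHS]mulrA.
(* A unit among the polynomials is a nonzero constant, so [c] is the constant term of [h]. *)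
case/andP: hU => /eqP Eh0 h0; exists h@_0; split.
  by apply: contraTneq h0 => ->; rewrite unitr0.
by rewrite Eh {1}Eh0 mul_mpolyC.
Qed.

Lemma det_DerX_basis A (c : K) :
  (forall i, DerX g (vfield (A i))) -> c != 0 -> \det A = c *: g -> DerX_basis A.
Proof.
move=> gA c0 detA; have detA0 : \det A != 0.
  by rewrite detA -mul_mpolyC mulf_neq0 // mpolyC_eq0.
split=> // [a|D [[b ->]]].
  (* Independence: a relation is a row vector killed by [A]; multiplying by the adjugate leaves
     [\det A] times it. *)
  rewrite sum_vfield => E.
  have {}E : (\row_i a i) *m A = 0.
    have aA0 : (fun j => \sum_i a i * A i j) =1 (fun=> 0).
      apply: vfield_inj; rewrite E; apply/funext => f.
      by rewrite vfieldE big1 // => k _; rewrite mul0r.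
    apply/rowP => j; rewrite !mxE -[RHS](aA0 j).
    by apply: eq_bigr => i _; rewrite mxE.
  move=> i; apply: (mulIf detA0); rewrite mul0r.
  have /rowP/(_ i) : (\row_i a i) *m A *m \adj A = 0 by rewrite E mul0mx.
  by rewrite -mulmxA mul_mx_adj mul_mx_scalar !mxE mulrC.
move=> gb; have gD i : dvdr g (\sum_j b j * \adj A j i).
  rewrite -det_row_subst; apply: DerX_dvdr_det => k; apply/DerXP.
  have [Ek|ki] := eqVneq k i.
    by under eq_bigr do rewrite mxE Ek eqxx; rewrite -vfieldE.
  by under eq_bigr do rewrite mxE (negPf ki); apply/DerXP.
(* The row [b] times the adjugate is [g] times [d]; multiplying by [A] gives [c *: g] times [b], so
   the coordinates of [b] are [d] divided by [c]. *)
have [d Ed] := choice gD; exists (fun i => c^-1 *: d i); rewrite sum_vfield.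
congr vfield; apply/funext => j; apply: (mulfI detA0).
have := congr1 (fun B : 'M[P]_n => ((\row_j b j) *m B) 0 j) (mul_adj_mx A).
rewrite mulmxA mul_mx_scalar !mxE => <-; rewrite detA mulr_sumr.
apply: eq_bigr => i _; rewrite mxE.
under eq_bigr do rewrite mxE.
rewrite Ed -scalerAl -scalerAl -scalerAr scalerA mulfV // scale1r.
by rewrite mulrA (mulrC g).
Qed.

End Saito.

Theorem proposition3p5 (R : realType) (n : nat) (g : {mpoly R[i][n]})
    (g_nonconstant : nonconstant g) (g_reduced : squarefree g)
    (alpha : 'M[{mpoly R[i][n]}]_n)
    (delta_DerX : forall i : 'I_n, DerX g (vfield (alpha i))) :
  is_basis_of (DerX g) (fun i : 'I_n => vfield (alpha i)) <->
  exists c : R[i], c != 0 /\ \det alpha = c *: g.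
Proof.
have charC : [pchar R[i]] =i pred0 := Num.Theory.pchar_num _.
have g0 : g != 0 by apply/eqP => g0; apply: (g_nonconstant 0); rewrite mpolyC0.
split; first exact: (DerX_basis_det charC g0 g_reduced).
by case=> c [c0]; apply: (det_DerX_basis charC g0 g_reduced).
Qed.
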